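(* If $n$ is a positive integer such that the angle $2\pi/n$ can be constructed (i.e. the regular polygon of $n$ sides can be constructed), then there exists a countable dense subset of the unit circle $S^1$ consisting of $n$-sectable angles.
   Context: Let $S\subseteq\mathbb{R}^2$ contain $(0,0)$ and $(1,0)$. A point is constructible over $S$ if it can be obtained from points of $S$ by a finite sequence of straightedge-and-compass steps: (1) given two distinct points already available, one may draw the line through them, or the circle centered at one of them and passing through the other; (2) given two lines, two circles, or a line and a circle already drawn, one may add their intersection points. $C(S)$ denotes the set of all points constructible over $S$. An angle is given by its radian measure $\alpha\in\mathbb{R}$ and is identified with the point $(\cos\alpha,\sin\alpha)\in S^1$. The angle $\alpha$ is constructible if $(\cos\alpha,\sin\alpha)\in C(\{(0,0),(1,0)\})$. The angle $\alpha$ is $n$-sectable if $(\cos(\alpha/n),\sin(\alpha/n))\in C(\{(0,0),(1,0),(\cos\alpha,\sin\alpha)\})$; when $2\pi/n$ is constructible this depends only on $\alpha$ modulo $2\pi$. *)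

(* Defs.v *)
From HB Require Import structures.
From mathcomp Require Import all_boot all_order all_algebra.
From mathcomp Require Import all_classical all_reals all_analysis.

Set Implicit Arguments.
Unset Strict Implicit.
Unset Printing Implicit Defensive.

Import Order.TTheory GRing.Theory Num.Theory.
Import numFieldNormedType.Exports.

Local Open Scope classical_set_scope.
Local Open Scope ring_scope.

Definition line_through (R : realType) (p q : R * R) : set (R * R) :=
  [set z | exists t : R, z = (p.1 + t * (q.1 - p.1), p.2 + t * (q.2 - p.2))].

(* The Euclidean circle, written out because the library norm on R * R is the
   sup norm. *)
Definition circle_through (R : realType) (c p : R * R) : set (R * R) :=
  [set z | (z.1 - c.1) ^+ 2 + (z.2 - c.2) ^+ 2 =
           (p.1 - c.1) ^+ 2 + (p.2 - c.2) ^+ 2].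

(* Curves are identified with their sets of points, so "two lines" (or circles)
   means two different subsets of the plane: a curve given by two different
   pairs of points must not be intersected with itself. *)
Inductive constructible (R : realType) (S : set (R * R)) : R * R -> Prop :=
| constructible_base p : S p -> constructible S p
| constructible_inter (C D : set (R * R)) p :
    drawn S C -> drawn S D -> C <> D -> C p -> D p -> constructible S p
with drawn (R : realType) (S : set (R * R)) : set (R * R) -> Prop :=
| drawn_line p q : constructible S p -> constructible S q -> p <> q ->
    drawn S (line_through p q)
| drawn_circle c p : constructible S c -> constructible S p -> c <> p ->
    drawn S (circle_through c p).

Scheme constructible_mut := Induction for constructible Sort Prop
with drawn_mut := Induction for drawn Sort Prop.

Definition unit_circle (R : realType) : set (R * R) :=
  [set z | z.1 ^+ 2 + z.2 ^+ 2 = 1].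

Definition angle_point (R : realType) (a : R) : R * R := (cos a, sin a).

Definition constructible_angle (R : realType) (a : R) : Prop :=
  constructible [set (0, 0); (1, 0)] (angle_point a).

Definition sectable (R : realType) (n : nat) (a : R) : Prop :=
  constructible [set (0, 0); (1, 0); angle_point a] (angle_point (a / n%:R)).

(* Density of A in the subspace X of T, where A is a subset of X; the library's
   dense is density in the whole space. *)
Definition dense_in (T : topologicalType) (X A : set T) : Prop :=
  A `<=` X /\ X `<=` closure A.

(* Main.v *)
Require Import Defs.
From mathcomp Require Import all_boot all_order all_algebra.
From mathcomp Require Import all_classical all_reals all_analysis.
From mathcomp Require Import ring lra.

Import Order.TTheory GRing.Theory Num.Theory.
Import numFieldNormedType.Exports.

Local Open Scope classical_set_scope.
Local Open Scope ring_scope.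

(** The constructible angles form a group closed under halving.  Reflecting
    [b - e] in the line through the origin and [b] gives [b + e], and a
    reflection is a single step: the second intersection of the circles about
    two points of the mirror.  Halving uses the rhombus spanned by two unit
    vectors.  The witness is the set of the angles [n * t] with [t] a dyadic
    multiple of [pi]: any [a] congruent to [n * t] modulo [2 * pi] has
    [a / n] congruent to [t] modulo [2 * pi / n]. *)

(** * Monotonicity in the base set and intersection of circles *)

Lemma constructible_sub {R : realType} {S T : set (R * R)} {p : R * R} :
  S `<=` T -> constructible S p -> constructible T p.
Proof.
move=> ST; move: p.
apply: (@constructible_mut R S (fun p _ => constructible T p)
  (fun C _ => drawn T C)).
- by move=> p /ST; exact: constructible_base.
- by move=> C D p _ TC _ TD CD Cp Dp; exact: constructible_inter TC TD CD Cp Dp.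
- by move=> p q _ Tp _ Tq pq; exact: drawn_line.
- by move=> c p _ Tc _ Tp cp; exact: drawn_circle.
Qed.

(** Curves are compared as point sets, so this is what turns distinct centers into the [C <> D]
    demanded by [constructible_inter]. *)
Lemma circle_through_center {R : realType} {c d p q : R * R} :
  c <> p -> circle_through c p = circle_through d q -> c = d.
Proof.
case: c d p q => [c1 c2] [d1 d2] [p1 p2] [q1 q2] cp E.
have sub z : circle_through (c1, c2) (p1, p2) z ->
    circle_through (d1, d2) (q1, q2) z by rewrite E.
(* The four points of the circle on two orthogonal diameters. *)
have := sub (c1 + (p1 - c1), c2 + (p2 - c2)).
have := sub (c1 - (p1 - c1), c2 - (p2 - c2)).
have := sub (c1 - (p2 - c2), c2 + (p1 - c1)).
have := sub (c1 + (p2 - c2), c2 - (p1 - c1)).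
rewrite /circle_through /=.
move=> /(_ ltac:(ring)) h1 /(_ ltac:(ring)) h2 /(_ ltac:(ring)) h3.
move=> /(_ ltac:(ring)) h4.
set u := p1 - c1 in h1 h2 h3 h4; set v := p2 - c2 in h1 h2 h3 h4.
(* Opposite ends of a diameter are equidistant from [d], so [c - d] is orthogonal to that diameter;
   this holds for both diameters. *)
have e1 : u * (c1 - d1) + v * (c2 - d2) = 0 by nra.
have e2 : v * (c1 - d1) - u * (c2 - d2) = 0 by nra.
have uv0 : u ^+ 2 + v ^+ 2 != 0.
  rewrite paddr_eq0 ?sqr_ge0// !sqrf_eq0 !subr_eq0; apply/negP.
  by move=> /andP[/eqP pc1 /eqP pc2]; apply: cp; rewrite pc1 pc2.
have f1 : (u ^+ 2 + v ^+ 2) * (c1 - d1) = 0.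
  have -> : (u ^+ 2 + v ^+ 2) * (c1 - d1) =
    u * (u * (c1 - d1) + v * (c2 - d2)) + v * (v * (c1 - d1) - u * (c2 - d2)).
    by ring.
  by rewrite e1 e2 !mulr0 addr0.
have f2 : (u ^+ 2 + v ^+ 2) * (c2 - d2) = 0.
  have -> : (u ^+ 2 + v ^+ 2) * (c2 - d2) =
    v * (u * (c1 - d1) + v * (c2 - d2)) - u * (v * (c1 - d1) - u * (c2 - d2)).
    by ring.
  by rewrite e1 e2 !mulr0 subr0.
move/eqP: f1; rewrite mulf_eq0 (negbTE uv0) subr_eq0 /= => /eqP ->.
by move/eqP: f2; rewrite mulf_eq0 (negbTE uv0) subr_eq0 /= => /eqP ->.
Qed.

Lemma constructible_circles {R : realType} {S : set (R * R)}
    {c d p q z : R * R} :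
  constructible S c -> constructible S p -> c <> p ->
  constructible S d -> constructible S q -> d <> q -> c <> d ->
  circle_through c p z -> circle_through d q z -> constructible S z.
Proof.
move=> Sc Sp cp Sd Sq dq cd cz dz.
apply: (constructible_inter (drawn_circle Sc Sp cp) (drawn_circle Sd Sq dq)) => //.
by move/(circle_through_center cp).
Qed.

(** * Basic constructible points and angles *)

Lemma eq_constructible_angle {R : realType} {a b : R} :
  cos a = cos b -> sin a = sin b ->
  constructible_angle a -> constructible_angle b.
Proof. by rewrite /constructible_angle /angle_point => -> ->. Qed.

Lemma constructible_origin {R : realType} :
  constructible [set (0, 0); (1, 0)] ((0, 0) : R * R).
Proof. by apply: constructible_base; left. Qed.

Lemma constructible_unit {R : realType} :
  constructible [set (0, 0); (1, 0)] ((1, 0) : R * R).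
Proof. by apply: constructible_base; right. Qed.

Lemma constructible_angle0 {R : realType} : constructible_angle (0 : R).
Proof.
by rewrite /constructible_angle /angle_point cos0 sin0; exact: constructible_unit.
Qed.

Lemma origin_neq_angle_point {R : realType} (a : R) : (0, 0) <> angle_point a.
Proof.
move=> [c0 s0]; have := cos2Dsin2 a; rewrite -c0 -s0 !expr0n /= addr0.
by move/eqP; rewrite eq_sym oner_eq0.
Qed.

Lemma origin_neq_unit {R : realType} : ((0, 0) : R * R) <> (1, 0).
Proof. by move=> [] /eqP; rewrite eq_sym oner_eq0. Qed.

Lemma unit_circle_angle_point {R : realType} (a : R) :
  circle_through (0, 0) (1, 0) (angle_point a).
Proof.
by rewrite /circle_through /angle_point /= !subr0 cos2Dsin2 expr1n expr0n addr0.
Qed.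

(** The line through the origin and [p] meets the unit circle in two antipodal points; a negative
    [t] selects the one opposite to [p]. *)
Lemma constructible_angle_line {R : realType} {p : R * R} {a t : R} :
  constructible [set (0, 0); (1, 0)] p -> p <> (0, 0) ->
  angle_point a = (t * p.1, t * p.2) -> constructible_angle a.
Proof.
move=> Sp p0 at_p.
apply: (constructible_inter
  (drawn_line constructible_origin Sp (fun e => p0 (esym e)))
  (drawn_circle constructible_origin constructible_unit origin_neq_unit)).
(* The line contains the origin and the circle does not, so the two curves differ. *)
- move=> E; have : circle_through ((0, 0) : R * R) (1, 0) (0, 0).
    by rewrite -E; exists 0; rewrite !mul0r !addr0.
  rewrite /circle_through /= !subr0 expr1n expr0n /= !addr0 => /eqP.
  by rewrite eq_sym oner_eq0.
- by exists t; rewrite at_p !subr0 !add0r.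
- exact: unit_circle_angle_point.
Qed.

Lemma constructible_angle_pi {R : realType} : constructible_angle (pi : R).
Proof.
apply: (@constructible_angle_line _ (1, 0) _ (-1)); first exact: constructible_unit.
- by move/esym; exact: origin_neq_unit.
- by rewrite /angle_point cospi sinpi mulr1 mulr0.
Qed.

(** * Closure of the constructible angles under reflection, halving and addition *)

Lemma constructible_angle_reflect {R : realType} {b e : R} :
  constructible_angle (b - e) -> constructible_angle b ->
  constructible_angle (b + e).
Proof.
move=> Sbe Sb.
(* If the two points coincide, the circle about [b] degenerates, but then [b + e] is the same point
   as [b]. *)
have [E|ne] := EM (angle_point b = angle_point (b - e)).
  have e1 : cos e = 1.
    have [cE sE] := E.
    have := cos2Dsin2 b; rewrite (_ : e = b - (b - e)); last by ring.
    by rewrite cosB -cE -sE !expr2.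
  have e0 : sin e = 0.
    by apply: cos1sin0; rewrite e1 normr1.
  by apply: eq_constructible_angle Sb; rewrite ?cosD ?sinD e1 e0; ring.
(* The points of [b - e] and [b + e] are equidistant from the origin and from [b]. *)
apply: (constructible_circles constructible_origin constructible_unit
  origin_neq_unit Sb Sbe ne (origin_neq_angle_point b)
  (unit_circle_angle_point _)).
by rewrite /circle_through /angle_point /= cosB cosD sinB sinD; ring.
Qed.

Lemma constructible_angleN {R : realType} {a : R} :
  constructible_angle a -> constructible_angle (- a).
Proof.
move=> Sa; rewrite -(add0r (- a)).
by apply: constructible_angle_reflect constructible_angle0; rewrite sub0r opprK.
Qed.

(** The sum of the unit vectors at [h - k] and [h + k] is a diagonal of their rhombus and points
    along [h], up to sign. It is nonzero when [cos k] is, and the two vectors differ when [sin k] is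
    nonzero. *)
Lemma constructible_angle_bisect {R : realType} {h k : R} :
  cos k != 0 -> sin k != 0 ->
  constructible_angle (h - k) -> constructible_angle (h + k) ->
  constructible_angle h.
Proof.
move=> ck sk Sm Sp; have hh := cos2Dsin2 h; have kk := cos2Dsin2 k.
have ne : angle_point (h - k) <> angle_point (h + k).
  rewrite /angle_point cosB cosD sinB sinD => -[e1 e2].
  have z1 : sin k * sin h = 0 by lra.
  have z2 : sin k * cos h = 0 by lra.
  apply: (@origin_neq_angle_point _ h); rewrite /angle_point.
  move/eqP: z1; rewrite mulf_eq0 (negbTE sk) /= => /eqP ->.
  by move/eqP: z2; rewrite mulf_eq0 (negbTE sk) /= => /eqP ->.
pose M := (2 * cos k * cos h, 2 * cos k * sin h).
have SM : constructible [set (0, 0); (1, 0)] M.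
  (* The vertex [M] lies on the unit circles about the two unit vectors, both of which pass through
     the origin. *)
  apply: (constructible_circles Sm constructible_origin _ Sp
    constructible_origin _ ne); try by move/esym; exact: origin_neq_angle_point.
  - by rewrite /circle_through /M /angle_point /= cosB sinB; ring.
  - by rewrite /circle_through /M /angle_point /= cosD sinD; ring.
apply: (@constructible_angle_line _ M _ (2 * cos k)^-1) => //.
- rewrite /M => -[] /eqP + /eqP; rewrite !mulf_eq0 (negbTE ck) pnatr_eq0 /=.
  move=> /eqP c0 /eqP s0; apply: (@origin_neq_angle_point _ h).
  by rewrite /angle_point c0 s0.
- by rewrite /M /angle_point /= !mulKf// mulf_neq0// pnatr_eq0.
Qed.

(* The angles [pi / 2 -+ asin (1 / 2)] are the apices of the equilateral
   triangles on the segments from the origin to [(1, 0)] and [(-1, 0)]. *)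
Lemma constructible_angle_pihalf {R : realType} :
  constructible_angle (pi / 2 : R).
Proof.
pose k : R := asin 2^-1.
have sk : sin k = 2^-1 by rewrite /k asinK// in_itv /=; apply/andP; split; lra.
have ck := cos2Dsin2 k; rewrite sk in ck.
(* With [u] equal to 1 or -1, the apex is common to the unit circles about the origin and
   [(u, 0)]. *)
have apex (u : R) (a : R) : u ^+ 2 = 1 -> constructible [set (0, 0); (1, 0)] (u, 0) ->
    angle_point a = (u / 2, cos k) -> constructible_angle a.
  move=> u1 Su aE; have u0 : (u, 0 : R) <> (0, 0).
    by move=> [] u0; move/eqP: u1; rewrite u0 expr0n eq_sym oner_eq0.
  apply: (constructible_circles constructible_origin constructible_unit
    origin_neq_unit Su constructible_origin u0 (fun e => u0 (esym e))
    (unit_circle_angle_point _)).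
  by rewrite aE /circle_through /=; nra.
apply: (@constructible_angle_bisect _ _ k).
- by apply/eqP => c0; move: ck; rewrite c0; lra.
- by rewrite sk invr_eq0 pnatr_eq0.
- apply: (apex 1); [by rewrite expr1n|exact: constructible_unit|].
  rewrite /angle_point -opprB cosN sinN cosBpihalf sinBpihalf sk opprK.
  by rewrite div1r.
- apply: (apex (-1)); first by rewrite sqrrN expr1n.
  + by have := @constructible_angle_pi R; rewrite /constructible_angle /angle_point
      cospi sinpi.
  + by rewrite /angle_point addrC cosDpihalf sinDpihalf sk mulN1r.
Qed.

(** Bisects the angle from 0 to [a]. The rhombus collapses when [a / 2] is a multiple of a right
    angle, and these four directions are treated separately. *)
Lemma constructible_angle_half {R : realType} {a : R} :
  constructible_angle a -> constructible_angle (a / 2).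
Proof.
set h := a / 2 => Sa; have hh := cos2Dsin2 h.
have [s0|s0] := eqVneq (sin h) 0.
  have /eqP : cos h ^+ 2 = 1 by rewrite -hh s0 expr0n addr0.
  rewrite sqrf_eq1 => /orP[] /eqP ch.
    by apply: eq_constructible_angle constructible_angle0; rewrite ?cos0 ?sin0.
  by apply: eq_constructible_angle constructible_angle_pi; rewrite ?cospi ?sinpi.
have [c0|c0] := eqVneq (cos h) 0.
  have /eqP : sin h ^+ 2 = 1 by rewrite -hh c0 expr0n add0r.
  rewrite sqrf_eq1 => /orP[] /eqP sh.
    by apply: eq_constructible_angle constructible_angle_pihalf;
      rewrite ?cos_pihalf ?sin_pihalf.
  by apply: eq_constructible_angle (constructible_angleN constructible_angle_pihalf);
    rewrite ?cosN ?sinN ?cos_pihalf ?sin_pihalf.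
apply: (constructible_angle_bisect c0 s0).
- by rewrite subrr; exact: constructible_angle0.
- by rewrite /h -splitr.
Qed.

Lemma constructible_angleD {R : realType} {a b : R} :
  constructible_angle a -> constructible_angle b -> constructible_angle (a + b).
Proof.
(* A rotation by [b] is a product of two reflections: [a] goes to [- a], which the mirror at [b / 2]
   sends to [a + b]. *)
move=> Sa Sb; have -> : a + b = b / 2 + (a + b / 2) by field.
apply: constructible_angle_reflect (constructible_angle_half Sb).
rewrite (_ : _ - _ = - a); last by ring.
exact: constructible_angleN.
Qed.

Lemma constructible_angleMn {R : realType} {a : R} (k : nat) :
  constructible_angle a -> constructible_angle (a *+ k).
Proof.
move=> Sa; elim: k => [|k IHk]; first by rewrite mulr0n; exact: constructible_angle0.
by rewrite mulrS; exact: constructible_angleD.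
Qed.

Lemma constructible_angle_dyadic {R : realType} {a : R} (m : nat) :
  constructible_angle a -> constructible_angle (a / 2 ^+ m).
Proof.
move=> Sa; elim: m => [|m IHm]; first by rewrite expr0 divr1.
by rewrite exprSr invfM mulrA; exact: constructible_angle_half.
Qed.

(** * Reduction modulo a period *)

Lemma truncn_remainder {R : realType} (x p : R) : 0 <= x -> 0 < p ->
  0 <= x - p *+ Num.truncn (x / p) < p.
Proof.
move=> x0 p0; have /truncn_itv/andP[] : 0 <= x / p by rewrite divr_ge0// ltW.
rewrite ler_pdivlMr// ltr_pdivrMr// => lo hi.
rewrite subr_ge0 ltrBlDl -mulrSr -!(mulr_natl p).
by rewrite lo hi.
Qed.

Lemma cos_eq1 {R : realType} (c : R) : cos c = 1 ->
  exists j : nat, `|c| = (2 * pi) *+ j.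
Proof.
rewrite -cos_norm => c1; have pi0 := @pi_gt0 R.
have p0 : 0 < 2 * pi :> R by lra.
have /andP[] := @truncn_remainder R `|c| _ (normr_ge0 c) p0.
set j := Num.truncn _; set r := _ - _ => r0 r2; exists j.
suff : r = 0 by move/eqP; rewrite subr_eq0 => /eqP.
have r1 : cos r = 1.
  rewrite -(periodicn (@cosD2pi R) j) -[X in _ = X]c1; congr cos.
  by rewrite /r -(mulr_natl pi 2) subrK.
(* The cosine is injective only on [[0, pi]], so a remainder beyond [pi] is replaced by
   [2 * pi - r]; that would vanish, against [r < 2 * pi]. *)
have [rpi|rpi] := leP r pi.
  apply: cos_inj; last by rewrite r1 cos0.
    by rewrite in_itv /= r0 rpi.
  by rewrite in_itv /= lexx ltW.
have : 2 * pi - r = 0.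
  apply: cos_inj.
  - by rewrite in_itv /=; apply/andP; split; lra.
  - by rewrite in_itv /= lexx ltW.
  by rewrite cos0 -[RHS]r1 -[RHS]cosN -[RHS]cosD2pi mulr_natl addrC.
by lra.
Qed.

(** * Arguments of unit vectors and density of the dyadic multiples *)

Lemma unit_circle_argument {R : realType} (z : R * R) : unit_circle z ->
  exists2 t : R, 0 <= t & z = angle_point t.
Proof.
case: z => x y; rewrite /unit_circle /= => xy.
have x1 : -1 <= x <= 1 by apply/andP; split; nra.
have y2 : 1 - x ^+ 2 = y ^+ 2 by rewrite -xy addrAC subrr add0r.
have cx : cos (acos x) = x by rewrite acosK// in_itv.
have sx : sin (acos x) = `|y| by rewrite sin_acos// y2 sqrtr_sqr.
have [y0|y0] := leP 0 y.
  by exists (acos x); [exact: acos_ge0|rewrite /angle_point cx sx ger0_norm].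
(* The full turn keeps the argument nonnegative, so that natural multiples can approximate it from
   below. *)
exists (- acos x + pi *+ 2).
  by have := acos_lepi x1; have := @pi_gt0 R; rewrite -mulr_natl; lra.
by rewrite /angle_point cosD2pi sinD2pi cosN sinN cx sx ltr0_norm ?opprK.
Qed.

Lemma continuous_angle_point {R : realType} : continuous (@angle_point R).
Proof. by move=> t; exact: (cvg_pair (@continuous_cos R t) (@continuous_sin R t)). Qed.

Definition dyadic_multiples {R : realType} (c : R) : set (R * R) :=
  range (fun km : nat * nat => angle_point (c / 2 ^+ km.2 *+ km.1)).

Lemma countable_dyadic_multiples {R : realType} (c : R) :
  countable (dyadic_multiples c).
Proof. exact: sub_countable (card_image_le _ _) (countableP _). Qed.

Lemma dense_dyadic_multiples {R : realType} (c : R) : 0 < c ->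
  dense_in (@unit_circle R) (dyadic_multiples c).
Proof.
move=> c0; split; first by move=> _ [km _ <-]; exact: cos2Dsin2.
move=> _ /unit_circle_argument[t t0 ->] B /continuous_angle_point.
rewrite -nbhs_ballE => -[e /= e0 eB].
(* This makes the mesh finer than [e], since [c / e < m + 1 <= 2 ^ m]. *)
pose m := Num.truncn (c / e).
have m2 : c / 2 ^+ m < e.
  rewrite ltr_pdivrMr ?exprn_gt0// mulrC -ltr_pdivrMr//.
  apply: (lt_le_trans (truncnS_gt _)).
  by rewrite -natrX ler_nat; exact: ltn_expl.
have p0 : 0 < c / 2 ^+ m by rewrite divr_gt0// exprn_gt0.
have /andP[r0 r1] := @truncn_remainder R t _ t0 p0.
set k := Num.truncn _ in r0 r1.
exists (angle_point (c / 2 ^+ m *+ k)); split; first by exists (k, m).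
by apply: eB; rewrite /ball /= ger0_norm// (lt_trans r1).
Qed.

Theorem propositionA1 (R : realType) (n : nat) (n_gt0 : (0 < n)%N)
    (constr_n : constructible_angle (2 * pi / n%:R : R)) :
  exists A : set (R * R),
    [/\ countable A,
        dense_in (@unit_circle R) A &
        forall a : R, A (angle_point a) -> sectable n a].
Proof.
have n0 : 0 < n%:R :> R by rewrite ltr0n.
exists (dyadic_multiples (n%:R * pi)); split.
- exact: countable_dyadic_multiples.
- by apply: dense_dyadic_multiples; rewrite mulr_gt0// pi_gt0.
move=> a [[k m] _ /=]; pose t : R := pi / 2 ^+ m *+ k.
have -> : n%:R * pi / 2 ^+ m *+ k = n%:R * t by rewrite /t mulrnAr mulrA.
move=> [ct st].
apply: (@constructible_sub _ [set (0, 0); (1, 0)]); first by move=> z; left.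
have /cos_eq1[j aE] : cos (a - n%:R * t) = 1.
  by rewrite cosB ct st -!expr2 cos2Dsin2.
have phiE : `|a / n%:R - t| = (2 * pi / n%:R) *+ j.
  rewrite (_ : _ - _ = (a - n%:R * t) / n%:R); last by field; rewrite gt_eqF.
  by rewrite normrM aE normfV (gtr0_norm n0) [LHS]mulrnAl.
rewrite -[X in angle_point X](subrK t); apply: constructible_angleD; last first.
  exact/constructible_angleMn/constructible_angle_dyadic/constructible_angle_pi.
have Sj := constructible_angleMn j constr_n; rewrite -phiE in Sj.
(* Only the absolute value is known to be a natural multiple of [2 * pi / n]; negation settles the
   sign. *)
have [r0|r0] := leP 0 (a / n%:R - t); first by rewrite ger0_norm in Sj.
by rewrite -[_ - _]opprK -(ltr0_norm r0); exact: constructible_angleN.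
Qed.
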